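(* Let $0<\beta<\alpha<1$ satisfy $$\frac{1-\beta}{\alpha}\sqrt{\frac{1}{2\pi}}\,\frac{e^{-\left(\operatorname{erfinv}\left(2\frac{1-\alpha}{1-\beta}-1\right)\right)^2}}{\sqrt{2}\,\operatorname{erfinv}\left(2\frac{1-\alpha}{1-\beta}-1\right)}=1 .$$ Then the net exponent of the geometric (polytope angle) analysis of $\ell_1$-optimization for nonnegative sparse vectors vanishes at $(\alpha,\beta)$: $$\Psi_{net}^{+}(\beta,\alpha)=\Psi_{com}^{+}(\beta,\alpha)-\Psi_{int}^{+}(\beta,\alpha)-\Psi_{ext}^{+}(\beta,\alpha)=0 .$$
   Context: $\log$ is the natural logarithm, $\operatorname{erf}(r)=\frac{2}{\sqrt{\pi}}\int_0^r e^{-q^2}\,dq$, and $\operatorname{erfinv}$ is its inverse. For $0<\beta<\alpha<1$ the exponents are defined as follows. Combinatorial exponent: $\Psi_{com}^{+}(\beta,\alpha)=(1-\beta)H\left(\frac{\alpha-\beta}{1-\beta}\right)$, where $H(p)=-p\log p-(1-p)\log(1-p)$. Internal angle exponent: put $\gamma=\beta/\alpha$, $\Phi(s)=\frac{1}{\sqrt{2\pi}}\int_s^\infty e^{-x^2/2}\,dx$, $\phi(s)=\frac{1}{\sqrt{2\pi}}e^{-s^2/2}$. Let $s_\gamma^{+}>0$ be the solution of $\Phi(s)=(1-\gamma)\frac{\phi(s)}{s}$, let $y_\gamma^{+}=\frac{\gamma}{1-\gamma}s_\gamma^{+}$, and let $\xi_\gamma^{+}(y_\gamma^{+})=-\frac12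 (y_\gamma^{+})^2\frac{1-\gamma}{\gamma}-\frac12\log\frac{2}{\pi}+\log\frac{y_\gamma^{+}}{\gamma}$. Then $\Psi_{int}^{+}(\beta,\alpha)=(\alpha-\beta)\xi_\gamma^{+}(y_\gamma^{+})+(\alpha-\beta)\log 2$. External angle exponent: $\Psi_{ext}^{+}(\beta,\alpha)=\min_{y\ge 0}\left(\alpha y^2-(1-\alpha)\log\left(\tfrac12(1+\operatorname{erf}(y))\right)\right)$. *)

(* Defs.v *)
From HB Require Import structures.
From mathcomp Require Import all_boot all_order all_algebra.
From mathcomp Require Import all_classical all_reals all_analysis.

Set Implicit Arguments.
Unset Strict Implicit.
Unset Printing Implicit Defensive.

Import Order.TTheory GRing.Theory Num.Theory.
Import numFieldNormedType.Exports.

Local Open Scope classical_set_scope.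
Local Open Scope ring_scope.

Section Defs.
Context {R : realType}.
Implicit Types (r s y p : R) (alpha beta gamma : R) (A : set R).

(* The integral from 0 to r is oriented: set integrals ignore orientation, so
   negative r needs its own branch. *)
Definition erf r : R :=
  2 / Num.sqrt pi *
  (if 0 <= r then \int[lebesgue_measure]_(q in `[0, r]) expR (- q ^+ 2)
   else - \int[lebesgue_measure]_(q in `[r, 0]) expR (- q ^+ 2)).

(* erf is a strictly increasing bijection from R onto ]-1, 1[; outside this
   interval no preimage exists and erfinv takes the junk value 0. *)
Definition erfinv p : R := xget 0 [set r | erf r = p].

(* The least element of A; the junk value 0 is only taken when there is none. *)
Definition setmin A : R := xget 0 (A `&` lbound A).

Definition entropy p : R := - p * ln p - (1 - p) * ln (1 - p).

Definition Psi_com beta alpha : R :=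
  (1 - beta) * entropy ((alpha - beta) / (1 - beta)).

Definition gauss_tail s : R :=
  1 / Num.sqrt (2 * pi) *
  \int[lebesgue_measure]_(x in `[s, +oo[) expR (- x ^+ 2 / 2).

Definition gauss_density s : R :=
  1 / Num.sqrt (2 * pi) * expR (- s ^+ 2 / 2).

(* For 0 < gamma < 1 the equation has exactly one positive solution, since
   s * gauss_tail s / gauss_density s increases from 0 to 1 on ]0, +oo[. *)
Definition s_int gamma : R :=
  xget 0 [set s | 0 < s /\
                  gauss_tail s = (1 - gamma) * (gauss_density s / s)].

Definition y_int gamma : R := gamma / (1 - gamma) * s_int gamma.

Definition xi_int gamma y : R :=
  - (1 / 2) * y ^+ 2 * ((1 - gamma) / gamma)
  - 1 / 2 * ln (2 / pi) + ln (y / gamma).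

Definition Psi_int beta alpha : R :=
  let gamma := beta / alpha in
  (alpha - beta) * xi_int gamma (y_int gamma) + (alpha - beta) * ln 2.

Definition Psi_ext beta alpha : R :=
  setmin [set alpha * y ^+ 2 - (1 - alpha) * ln (1 / 2 * (1 + erf y))
         | y in [set y | 0 <= y]].

Definition Psi_net beta alpha : R :=
  Psi_com beta alpha - Psi_int beta alpha - Psi_ext beta alpha.

End Defs.

(* Main.v *)
Require Import Defs.
From mathcomp Require Import all_boot all_order all_algebra.
From mathcomp Require Import all_classical all_reals all_analysis.
From mathcomp Require Import measurable_realfun ring lra.

Import Order.TTheory GRing.Theory Num.Theory.
Import numFieldNormedType.Exports.

Local Open Scope classical_set_scope.
Local Open Scope ring_scope.

(* Write e = erfinv (2 (1 - alpha) / (1 - beta) - 1).  The hypothesis forces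
   e > 0, since its left-hand side is nonpositive otherwise (and it is 0 when
   erfinv takes its junk value).  It says that e is a critical point of the
   objective of Psi_ext, and that s = sqrt 2 * e solves the equation defining
   s_int.  Minimality of e follows without differentiating: bound ln (1 + u) by
   u and the concave function erf by its tangent.  Uniqueness of s: the gap
   tail s - c * density s / s has derivative density s * (c - 1 + c / s^2), so
   between two zeros, by Rolle, this changes sign; the gap is then strictly
   decreasing and negative after the second zero, yet bounded below by a
   quantity tending to 0.  With these values the exponents cancel. *)

Section GaussianIntegrals.
Context {R : realType}.
Implicit Types (r s x y c : R) (D : set R).

Local Notation mu := (@lebesgue_measure R).

(** * The error function on the half-line: increments, tangent bound, derivative *)

Lemma integrable_gauss_fun D : measurable D ->
  mu.-integrable D (EFin \o @gauss_fun R).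
Proof.
by move=> mD; apply: integrableS integrableT_gauss.
Qed.

Lemma erf_ge0E r : 0 <= r ->
  erf r = 2 / Num.sqrt pi * \int[mu]_(q in `[0, r]) gauss_fun q.
Proof. by rewrite /erf => ->. Qed.

Lemma erfB x y : 0 <= x <= y ->
  erf y - erf x = 2 / Num.sqrt pi * \int[mu]_(q in `]x, y]) gauss_fun q.
Proof.
move=> /andP[x0 xy]; rewrite !erf_ge0E ?(le_trans x0)// -mulrBr.
by rewrite Rintegral_itvB ?bnd_simp//; exact: integrable_gauss_fun.
Qed.

Lemma oneBerf r : 0 <= r ->
  1 - erf r = 2 / Num.sqrt pi * \int[mu]_(q in `[r, +oo[) gauss_fun q.
Proof.
move=> r0.
have spi0 : Num.sqrt pi != 0 :> R by rewrite gt_eqF// sqrtr_gt0 pi_gt0.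
have {1}-> : 1 = 2 / Num.sqrt pi * \int[mu]_(q in `[0, +oo[) gauss_fun q :> R.
  by rewrite /Rintegral integral0y_gauss/=; field.
rewrite erf_ge0E// -mulrBr Rintegral_itvB ?bnd_simp//.
  by rewrite Rintegral_itv_obnd_cbnd//; exact: integrable_gauss_fun.
exact: integrable_gauss_fun.
Qed.

Lemma gauss_fun_antitone x y : 0 <= x <= y -> gauss_fun y <= gauss_fun x.
Proof.
move=> /andP[x0 xy]; rewrite /gauss_fun ler_expR lerN2.
by rewrite ler_pXn2r ?nnegrE// (le_trans x0).
Qed.

(** The integrand decreases on the half-line, so its integral over []x, y]] lies between its
    endpoint values times the length. *)
Lemma erfB_bounds x y : 0 <= x <= y ->
  2 / Num.sqrt pi * (gauss_fun y * (y - x)) <= erf y - erf x <=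
  2 / Num.sqrt pi * (gauss_fun x * (y - x)).
Proof.
move=> /[dup] xy0 /andP[x0 xy]; rewrite erfB//.
have k0 : 0 < 2 / Num.sqrt pi :> R by rewrite divr_gt0// sqrtr_gt0 pi_gt0.
have cstE k : k * (y - x) = \int[mu]_(q in `]x, y]) k.
  rewrite Rintegral_cst//= [lebesgue_measure _]lebesgue_measure_itv/= lte_fin.
  case: ltP => [//|yx].
  by rewrite (@le_anti _ _ x y) ?xy ?subrr.
have icst k : mu.-integrable `]x, y] (EFin \o (fun=> k)).
  apply/integrableP; split; first exact/measurable_EFinP.
  rewrite (_ : (fun=> _) = cst `|k|%:E)//.
  rewrite integral_cst//= [lebesgue_measure _]lebesgue_measure_itv/=.
  by case: ifP; rewrite ?mule0// -EFinD -EFinM ltry.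
have ig : mu.-integrable `]x, y] (EFin \o gauss_fun).
  exact: integrable_gauss_fun.
rewrite !ler_pM2l// !cstE; apply/andP; split; apply: le_Rintegral; rewrite ?icst //.
- move=> q /=; rewrite in_itv/= => /andP[xq qy].
  by rewrite gauss_fun_antitone// qy (le_trans x0 (ltW xq)).
- move=> q /=; rewrite in_itv/= => /andP[xq qy].
  by rewrite gauss_fun_antitone// x0 ltW.
Qed.

(** Concavity without derivatives: the upper half of [erfB_bounds] serves for [x <= y], the lower
    half with [x] and [y] exchanged otherwise. *)
Lemma erf_le_tangent x y : 0 <= x -> 0 <= y ->
  erf y - erf x <= 2 / Num.sqrt pi * (gauss_fun x * (y - x)).
Proof.
move=> x0 y0; have [xy|/ltW yx] := leP x y.
  by have := erfB_bounds x y; rewrite x0 xy => /(_ isT)/andP[].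
have := erfB_bounds y x; rewrite y0 yx => /(_ isT)/andP[+ _].
by rewrite -lerN2 opprB -!mulrN opprB.
Qed.

Lemma is_derive_erf x : 0 < x ->
  is_derive x 1 (@erf R) (2 / Num.sqrt pi * gauss_fun x).
Proof.
move=> x0.
(* Any right end beyond [x] would do; [x + 1] makes [x] an interior point. *)
have [] := @continuous_FTC1_closed R gauss_fun 0 x (x + 1).
- by rewrite ltrDl.
- exact: integrable_gauss_fun.
- by [].
- exact: continuous_gauss_fun.
rewrite derive1E => dI I'.
have := is_deriveZ (2 / Num.sqrt pi) (@DeriveDef _ _ _ _ _ _ _ dI I').
apply: near_eq_is_derive => //.
near=> y.
rewrite erf_ge0E//.
by apply: ltW; near: y; exact: lt_nbhsr.
Unshelve. all: by end_near. Qed.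

(** * Gaussian tail and density, reduced to [erf] by rescaling with the square root of 2 *)

Lemma Rintegral_gauss_sqrt2 r :
  \int[mu]_(x in `[Num.sqrt 2 * r, +oo[) expR (- x ^+ 2 / 2) =
  Num.sqrt 2 * \int[mu]_(q in `[r, +oo[) gauss_fun q.
Proof.
have s2 : 0 < Num.sqrt 2 :> R by rewrite sqrtr_gt0.
rewrite -RintegralZl//; last exact: integrable_gauss_fun.
rewrite /Rintegral; congr fine.
pose F x : R := Num.sqrt 2 * x.
have dF x : derivable F x 1 by apply: derivableM.
have F' : derive1 F = cst (Num.sqrt 2).
  by apply/funext => x; rewrite /F derive1Ml// derive1_id mulr1.
have cG : continuous (fun x : R => expR (- x ^+ 2 / 2)).
  move=> x; apply: continuous_comp; last exact: continuous_expR.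
  apply: cvgMr_tmp; apply: cvgN; exact: exprn_continuous.
rewrite -[Num.sqrt 2 * r]/(F r).
rewrite (@increasing_ge0_integration_by_substitutiony _ F).
- apply: eq_integral => x _; congr (_%:E).
  rewrite F' /= mulrC; congr (_ * expR _).
  by rewrite /F exprMn sqr_sqrtr//; field.
- by move=> x y _ _ xy; rewrite /F ltr_pM2l.
- by move=> x _; rewrite F'; exact: cvg_cst.
- by rewrite F'; exact: is_cvg_cst.
- by rewrite F'; exact: is_cvg_cst.
- split=> [x _//|].
  apply: cvg_at_right_filter.
  by apply/differentiable_continuous/derivable1_diffP.
- by apply: gt0_cvgMry.
- exact: continuous_subspaceT.
- by move=> x _; rewrite expR_ge0.
Qed.

Lemma gauss_tailE s : 0 <= s -> gauss_tail s = (1 - erf (s / Num.sqrt 2)) / 2.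
Proof.
move=> s0.
have s2 : 0 < Num.sqrt 2 :> R by rewrite sqrtr_gt0.
have s2' : Num.sqrt 2 != 0 :> R by rewrite gt_eqF.
have pi0 : Num.sqrt pi != 0 :> R by rewrite gt_eqF// sqrtr_gt0 pi_gt0.
rewrite oneBerf ?divr_ge0 ?(ltW s2)// /gauss_tail.
have {1}-> : s = Num.sqrt 2 * (s / Num.sqrt 2) by rewrite mulrC divfK.
rewrite Rintegral_gauss_sqrt2 sqrtrM//; field.
by rewrite pi0.
Qed.

Lemma is_derive_gauss_density s :
  is_derive s 1 (@gauss_density R) (- s * gauss_density s).
Proof.
rewrite /gauss_density.
pose e := fun x : R => - x ^+ 2 / 2.
have de : is_derive s 1 e (- s).
  rewrite (_ : e = (-2^-1) \*: (id ^+ 2)); last first.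
    by apply/funext => x; rewrite /e /= [RHS]mulrC mulrN mulNr.
  by apply: is_derive_eq; rewrite /GRing.scale/=; field.
have := is_deriveZ (1 / Num.sqrt (2 * pi)) (is_derive1_comp (is_derive_expR (e s)) de).
move=> h; apply: is_derive_eq h _.
by rewrite /GRing.scale/= /e; ring.
Qed.

Lemma is_derive_gauss_tail s : 0 < s ->
  is_derive s 1 (@gauss_tail R) (- gauss_density s).
Proof.
move=> s0.
have s2 : 0 < Num.sqrt 2 :> R by rewrite sqrtr_gt0.
have s2' : Num.sqrt 2 != 0 :> R by rewrite gt_eqF.
have pi0 : Num.sqrt pi != 0 :> R by rewrite gt_eqF// sqrtr_gt0 pi_gt0.
(* [g] is the closed form of [gauss_tailE]; it is known to agree with the tail only on the
   half-line, hence near [s > 0]. *)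
pose g := (2^-1 : R) \*: (cst 1 - (@erf R \o ((Num.sqrt 2)^-1 \*: id))).
have e0 : 0 < (Num.sqrt 2)^-1 * s by rewrite mulr_gt0 ?invr_gt0.
have := is_derive_erf _ e0 => de.
apply: (@near_eq_is_derive _ _ _ g).
  near=> x; rewrite gauss_tailE.
    by rewrite mulrC [x / _]mulrC.
  by apply: ltW; near: x; exact: lt_nbhsr.
have dl : is_derive s 1 ((Num.sqrt 2)^-1 \*: id) ((Num.sqrt 2)^-1 *: 1) by exact: is_deriveZ.
have := is_derive1_comp de dl.
move=> h; apply: is_derive_eq.
rewrite /gauss_density /gauss_fun exprMn exprVn sqr_sqrtr// sqrtrM//.
rewrite (_ : - (2^-1 * s ^+ 2) = - s ^+ 2 / 2); last by field.
rewrite /GRing.scale/=; field.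
by rewrite pi0.
Unshelve. all: by end_near. Qed.

Lemma gauss_tail_ge0 s : 0 <= gauss_tail s.
Proof.
rewrite /gauss_tail mulr_ge0 ?divr_ge0 ?sqrtr_ge0//.
by apply: Rintegral_ge0 => x _; exact: expR_ge0.
Qed.

Lemma gauss_density_gt0 s : 0 < gauss_density s.
Proof.
by rewrite /gauss_density mulr_gt0 ?expR_gt0// divr_gt0// sqrtr_gt0 mulr_gt0 ?pi_gt0.
Qed.

Lemma gauss_density_le s : gauss_density s <= 1 / Num.sqrt (2 * pi).
Proof.
rewrite /gauss_density ler_piMr ?divr_ge0 ?sqrtr_ge0//.
by rewrite -expR0 ler_expR mulNr oppr_le0 divr_ge0 ?sqr_ge0.
Qed.

(** * Uniqueness of the internal-angle parameter *)

Lemma is_derive_tail_gap c s : 0 < s ->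
  is_derive s 1 (fun x => gauss_tail x - c * (gauss_density x / x))
    (gauss_density s * (c - 1 + c / s ^+ 2)).
Proof.
move=> s0.
have s0' : s != 0 by rewrite gt_eqF.
have d1 := is_derive_gauss_tail _ s0.
have d2 := is_derive_gauss_density s.
have d3 := is_deriveV (f := id) s0' (is_derive_id s 1).
have d4 := is_deriveB d1 (is_deriveZ c (is_deriveM d2 d3)).
apply: is_derive_eq d4 _.
by rewrite /GRing.scale/=; field.
Qed.

Lemma mills_ratio_inj c x y : 0 < c -> 0 < x -> 0 < y ->
  gauss_tail x = c * (gauss_density x / x) ->
  gauss_tail y = c * (gauss_density y / y) -> x = y.
Proof.
move=> c0.
wlog xy : x y / x < y.
  move=> H x0 y0 hx hy.
  have [xy|yx|//] := ltgtP x y; first exact: H.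
  by apply/esym; exact: H.
move=> x0 y0 hx hy.
pose m t : R := gauss_tail t - c * (gauss_density t / t).
pose dm t : R := gauss_density t * (c - 1 + c / t ^+ 2).
have mD (t : R) : 0 < t -> is_derive t 1 m (dm t) by exact: is_derive_tail_gap.
have mC (a b : R) : 0 < a -> {within `[a, b], continuous m}.
  move=> a0; apply: derivable_within_continuous => t.
  by rewrite in_itv/= => /andP[/(lt_le_trans a0)/mD[]].
have my : m y = 0 by rewrite /m hy subrr.
have mx : m x = 0 by rewrite /m hx subrr.
have [z] : exists2 z, z \in `]x, y[ & is_derive z 1 m 0.
  apply: Rolle => //; [|exact: mC|by rewrite mx my].
  by move=> t; rewrite in_itv/= => /andP[/(lt_trans x0)/mD[]].
rewrite in_itv/= => /andP[xz zy] dz.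
have z0 := lt_trans x0 xz.
have cz : c - 1 + c / z ^+ 2 = 0.
  have : dm z = 0 by have [_ <-] := mD _ z0; have [_] := dz.
  by move/eqP; rewrite mulf_eq0 gt_eqF ?gauss_density_gt0//= => /eqP.
(* The factor [c - 1 + c / t ^+ 2] strictly decreases in [t] and vanishes at [z]. *)
have dm_lt0 (t : R) : z < t -> dm t < 0.
  move=> zt; have t0 := lt_trans z0 zt.
  rewrite /dm pmulr_rlt0 ?gauss_density_gt0// -cz ltrD2l ltr_pM2l//.
  by rewrite ltf_pV2 ?posrE ?exprn_gt0// ltr_pXn2r// nnegrE ltW.
have m_decr (a b : R) : z < a -> a < b -> m b < m a.
  move=> za ab; have a0 := lt_trans z0 za.
  have mDab : forall u, u \in `]a, b[ -> is_derive u 1 m (dm u).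
    by move=> u; rewrite in_itv/= => /andP[/(lt_trans a0)/mD].
  have [u] := MVT ab mDab (mC _ _ a0).
  rewrite in_itv/= => /andP[au _] mab.
  by rewrite -subr_lt0 mab pmulr_llt0 ?subr_gt0// dm_lt0// (lt_trans za).
pose k : R := 1 / Num.sqrt (2 * pi).
have k0 : 0 < k by rewrite divr_gt0// sqrtr_gt0 mulr_gt0 ?pi_gt0.
have m_ge (t : R) : 0 < t -> - (c * k / t) <= m t.
  move=> t0; rewrite /m -[leLHS]add0r lerD ?gauss_tail_ge0// lerN2 -mulrA.
  by rewrite ler_pM2l// ler_pM2r ?invr_gt0// gauss_density_le.
have m1 : m (y + 1) < 0 by rewrite -my m_decr// ltrDl.
(* Far enough out that [c * k / t <= - m (y + 1)]: then [m_ge] gives [m (y + 1) <= m t], against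
   strict decrease. *)
pose t : R := y + 1 + c * k / - m (y + 1).
have ck0 : 0 < c * k by rewrite mulr_gt0.
have t1 : y + 1 < t by rewrite ltrDl divr_gt0// oppr_gt0.
have t0 : 0 < t by rewrite (lt_trans _ t1)// addr_gt0.
have : m t < m (y + 1) by rewrite m_decr// (lt_trans zy)// ltrDl.
move=> /(le_lt_trans (m_ge _ t0)); rewrite ltNge => /negP[].
rewrite lerNr ler_pdivrMr// [leRHS]mulrC -ler_pdivrMr ?oppr_gt0//.
by rewrite /t lerDr addr_ge0// ltW.
Qed.

(** * Values selected by [erfinv], [s_int] and [setmin]; the external minimum *)

Lemma erf_ge0 r : 0 <= r -> 0 <= erf r.
Proof.
move=> r0; rewrite erf_ge0E// mulr_ge0 ?divr_ge0 ?sqrtr_ge0//.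
by apply: Rintegral_ge0 => q _; exact: gauss_fun_ge0.
Qed.

(** A nonzero value cannot be the default of [xget], so a preimage exists. *)
Lemma erfinvK (p : R) : erfinv p != 0 -> erf (erfinv p) = p.
Proof. by rewrite /erfinv; case: xgetP => [_ -> //|_]; rewrite eqxx. Qed.

Lemma s_int_eq (gamma : R) s : gamma < 1 -> 0 < s ->
  gauss_tail s = (1 - gamma) * (gauss_density s / s) -> s_int gamma = s.
Proof.
move=> g1 s0 hs; apply: xget_subset1 => //= x y [x0 hx] [y0 hy].
by apply: (@mills_ratio_inj (1 - gamma)); rewrite ?subr_gt0.
Qed.

Lemma setmin_eq (A : set R) x : A x -> lbound A x -> setmin A = x.
Proof.
move=> Ax lx; apply: xget_subset1 => //= y z [Ay ly] [Az lz].
by apply: le_anti; rewrite ly// lz.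
Qed.

(* The hypothesis says that [x] is a critical point of the objective. *)
Lemma Psi_ext_critical (beta alpha : R) x : 0 <= alpha <= 1 -> 0 <= x ->
  (1 - alpha) * gauss_fun x = Num.sqrt pi * alpha * x * (1 + erf x) ->
  Psi_ext beta alpha = alpha * x ^+ 2 - (1 - alpha) * ln (1 / 2 * (1 + erf x)).
Proof.
move=> /andP[a0 a1] x0 hx.
have pi0 : Num.sqrt pi != 0 :> R by rewrite gt_eqF// sqrtr_gt0 pi_gt0.
have A0 y : 0 <= y -> 0 < 1 + erf y.
  by move=> y0; rewrite ltr_wpDr// erf_ge0.
have A0' : 1 + erf x != 0 by rewrite gt_eqF// A0.
apply: setmin_eq => [|_ [y /= y0 <-]]; first by exists x.
have hln : ln (1 / 2 * (1 + erf y)) - ln (1 / 2 * (1 + erf x)) <=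
    (erf y - erf x) / (1 + erf x).
  rewrite -ln_div ?posrE ?mulr_gt0 ?A0//.
  rewrite (_ : 1 / 2 * (1 + erf y) / _ = 1 + (erf y - erf x) / (1 + erf x)); last by field.
  apply: le_ln1Dx; rewrite -subr_gt0.
  rewrite (_ : (erf y - erf x) / _ - -1 = (1 + erf y) / (1 + erf x)); last by field.
  by rewrite divr_gt0 ?A0.
(* Criticality [hx] turns the slope of the tangent bound into exactly [2 * alpha * x]. *)
have htan : (1 - alpha) * ((erf y - erf x) / (1 + erf x)) <=
    2 * alpha * x * (y - x).
  rewrite mulrA ler_pdivrMr ?A0//.
  apply: le_trans (_ : (1 - alpha) *
    (2 / Num.sqrt pi * (gauss_fun x * (y - x))) <= _).
    by rewrite ler_wpM2l ?subr_ge0// erf_le_tangent.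
  rewrite (_ : (1 - alpha) * _ = 2 / Num.sqrt pi * ((1 - alpha) * gauss_fun x) * (y - x));
    last by ring.
  by rewrite hx le_eqVlt; apply/orP; left; apply/eqP; field.
have a1' : 0 <= 1 - alpha by rewrite subr_ge0.
have := ler_wpM2l a1' hln.
(* This square is what remains of [alpha * (y ^+ 2 - x ^+ 2)] after subtracting the bound of
   [htan]. *)
have : 0 <= alpha * (y - x) ^+ 2 by rewrite mulr_ge0// sqr_ge0.
nra.
Qed.

End GaussianIntegrals.

(** * Evaluation of the three exponents at the critical point *)

Theorem mainTheorem4 (R : realType) (alpha beta : R)
  (hbeta : 0 < beta) (hba : beta < alpha) (halpha : alpha < 1)
  (hab : (1 - beta) / alpha * Num.sqrt (1 / (2 * pi)) *
         (expR (- erfinv (2 * ((1 - alpha) / (1 - beta)) - 1) ^+ 2) /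
          (Num.sqrt 2 * erfinv (2 * ((1 - alpha) / (1 - beta)) - 1))) = 1) :
  Psi_net beta alpha = 0.
Proof.
set p := 2 * _ - 1 in hab.
set e := erfinv p in hab.
have a0 : 0 < alpha := lt_trans hbeta hba.
have b1 : 0 < 1 - beta by rewrite subr_gt0 (lt_trans hba).
have a1 : 0 < 1 - alpha by rewrite subr_gt0.
have ab : 0 < alpha - beta by rewrite subr_gt0.
have spi : 0 < Num.sqrt pi :> R by rewrite sqrtr_gt0 pi_gt0.
have s2 : 0 < Num.sqrt 2 :> R by rewrite sqrtr_gt0.
have s2E : Num.sqrt 2 ^+ 2 = 2 :> R by rewrite sqr_sqrtr.
have spiE : Num.sqrt pi ^+ 2 = pi :> R by rewrite sqr_sqrtr// pi_ge0.
have nz := (lt0r_neq0 a0, lt0r_neq0 b1, lt0r_neq0 a1, lt0r_neq0 ab,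
  lt0r_neq0 spi, lt0r_neq0 s2, lt0r_neq0 hbeta).
rewrite -/(gauss_fun e) div1r sqrtrV ?mulr_ge0 ?pi_ge0// sqrtrM// in hab.
have g0 : 0 < gauss_fun e := expR_gt0 _.
have e0 : 0 < e.
  rewrite ltNge; apply/negP => e_le0.
  have := ltr01 (R := R); rewrite -hab ltNge => /negP; apply.
  apply: mulr_ge0_le0.
    by rewrite mulr_ge0 ?divr_ge0 ?invr_ge0 ?mulr_ge0 ?ltW.
  by rewrite mulr_ge0_le0 ?(ltW g0)// invr_le0 mulr_ge0_le0 ?(ltW s2).
have e0' := lt0r_neq0 e0.
have erfe : erf e = p by apply: erfinvK.
have key : (1 - beta) * gauss_fun e = 2 * Num.sqrt pi * alpha * e.
  (* The factor 1 is there to be replaced by the left side of [hab]; [2 / Num.sqrt 2 ^+ 2] equals 1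
     but is kept formal for [field]. *)
  have : 2 * Num.sqrt pi * alpha * e * 1 =
      2 / Num.sqrt 2 ^+ 2 * ((1 - beta) * gauss_fun e).
    by rewrite -[X in _ * X = _]hab; field; rewrite !nz e0'.
  by rewrite mulr1 s2E => ->; field.
have gE : gauss_fun e = 2 * Num.sqrt pi * alpha * e / (1 - beta).
  by rewrite -key [_ * gauss_fun e]mulrC mulfK ?nz.
have extE : Psi_ext beta alpha =
    alpha * e ^+ 2 - (1 - alpha) * ln ((1 - alpha) / (1 - beta)).
  rewrite (@Psi_ext_critical _ _ _ e) ?ltW//.
  - by rewrite erfe /p; congr (_ - _ * ln _); field; rewrite nz.
  - by rewrite erfe gE /p; field; rewrite nz.
(* Both sides of the equation equal [(alpha - beta) / (1 - beta)], the left one because it is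
   [(1 - p) / 2]. *)
have sE : s_int (beta / alpha) = Num.sqrt 2 * e.
  apply: s_int_eq.
  - by rewrite ltr_pdivrMr// mul1r.
  - by rewrite mulr_gt0.
  - rewrite gauss_tailE ?mulr_ge0 ?ltW// mulrAC divff ?nz// mul1r erfe.
    rewrite /gauss_density exprMn s2E sqrtrM//.
    rewrite (_ : - (2 * e ^+ 2) / 2 = - e ^+ 2); last by field.
    rewrite -/(gauss_fun e) gE /p.
    rewrite [RHS](_ : _ = (alpha - beta) / (1 - beta) * (2 / Num.sqrt 2 ^+ 2)).
      by rewrite s2E; field; rewrite nz.
    by field; rewrite !nz e0'.
(* By [gE] the arguments of the logarithms multiply to [gauss_fun e * (1 - beta) / (alpha -
   beta)]. *)
have lnE : - 1 / 2 * ln (2 / pi) +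
    ln (Num.sqrt 2 * e / (1 - beta / alpha)) + ln 2 =
    - ln ((alpha - beta) / (1 - beta)) - e ^+ 2.
  have -> : - 1 / 2 * ln (2 / pi) = ln (Num.sqrt pi / Num.sqrt 2) :> R.
    have -> : ln (2 / pi) = - (ln (Num.sqrt pi / Num.sqrt 2) *+ 2) :> R.
      rewrite -lnXn ?divr_gt0// expr_div_n spiE s2E.
      by rewrite -lnV ?posrE ?divr_gt0 ?pi_gt0// invf_div.
    by field.
  have gb : 0 < 1 - beta / alpha by rewrite subr_gt0 ltr_pdivrMr// mul1r.
  rewrite -!lnM ?posrE ?mulr_gt0 ?divr_gt0 ?invr_gt0//.
  rewrite -lnV ?posrE ?divr_gt0// -[- e ^+ 2]expRK -lnM ?posrE ?expR_gt0 ?invr_gt0 ?divr_gt0//.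
  congr ln; rewrite -/(gauss_fun e) gE; field.
  by rewrite !nz.
rewrite /Psi_net extE /Psi_int /Psi_com /entropy /xi_int /y_int sE.
have -> : beta / alpha / (1 - beta / alpha) * (Num.sqrt 2 * e) / (beta / alpha) =
  Num.sqrt 2 * e / (1 - beta / alpha).
  by field; rewrite !nz.
have -> : 1 - (alpha - beta) / (1 - beta) = (1 - alpha) / (1 - beta).
  by field; rewrite nz.
set L := ln ((alpha - beta) / _) in lnE *.
set M := ln ((1 - alpha) / _).
set N := ln (_ / (1 - beta / alpha)) in lnE *.
set K := ln (2 / pi) in lnE *.
(* After this substitution the exponents are [- (alpha - beta) * L - (1 - alpha) * M]
   (combinatorial), [- (alpha - beta) * L - alpha * e ^+ 2] (internal) and
   [alpha * e ^+ 2 - (1 - alpha) * M] (external). *)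
have NE : N = - L - e ^+ 2 - ln 2 + 1 / 2 * K by move: lnE; lra.
rewrite NE exprMn [(Num.sqrt 2 * e) ^+ 2]exprMn s2E.
field.
by rewrite !nz.
Qed.
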